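(* Let $\mathbb X,\mathbb Y$ be finite-dimensional Hilbert spaces, $\lambda>0$, $b\in\mathbb Y$. Let $f:\mathbb X\to\mathbb R\cup\{+\infty\}$ be proper, lower semicontinuous and prox-bounded with threshold $\lambda_f>\lambda$, let $A:\mathbb X\to\mathbb Y$ be a surjective linear operator, let $\mathcal E=\{x\in\mathbb X:Ax=b\}$, and let $\bar x\in\mathcal F:=\mathcal E\cap\operatorname{dom} f$. Suppose that $f$ and $\delta_{\mathcal E}$ satisfy the nonconvex subdifferential sum rule (NSSR) at $\bar x$, and that $f$ is prox-regular at $\bar x$ for $\bar v=0$ with constant $\rho\in(0,1/\lambda)$ and $\bar x=\operatorname{Prox}_{f/\rho}(\bar x)$. Then, for any $z$ sufficiently close to $\bar x$, the following statements are equivalent: (i) the mapping $T_z$, defined on $\mathcal U:=A^*\mathbb Y$ by $T_z(u)=\operatorname{Prox}_{\lambda f}(z+u)$, is locally strongly monotone at $A^*y_z$; (ii) the dual problem $\min_{y\in\mathbb Y}\Phi_z(y)$ is locally strongly convex at its unique optimal solution $y_z$.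
   Context: $\delta_{\mathcal E}$ is the indicator function of $\mathcal E$; $A^*$ is the adjoint of $A$; $\mathbb B_r(x)$ is the open ball of radius $r$ about $x$; $\partial$ denotes the limiting (Mordukhovich) subdifferential. $E_h(t)=\inf_x\{h(x)+\tfrac12\|x-t\|^2\}$ and $\operatorname{Prox}_h(t)=\arg\min_x\{h(x)+\tfrac12\|x-t\|^2\}$ (in general set-valued); $\bar x=\operatorname{Prox}_{f/\rho}(\bar x)$ means that $\operatorname{Prox}_{f/\rho}(\bar x)=\{\bar x\}$. The dual objective is $\Phi_z(y)=-\inf_{x\in\mathbb X}\{\lambda f(x)+\tfrac12\|x-z\|^2+\langle y,b-Ax\rangle\}$, associated with the primal problem $\min_x\{\lambda f(x)+\tfrac12\|x-z\|^2:Ax=b\}$. In both (i) and (ii), $y_z$ denotes the optimal solution of the dual problem $\min_{y\in\mathbb Y}\Phi_z(y)$. $T_z$ is locally strongly monotone at $\bar u\in\mathcal U$ if there are $\epsilon_{\bar u}>0$, $c>0$ such that $\langle T_z(u_1)-T_z(u_2),u_1-u_2\rangle\ge c\|u_1-u_2\|^2$ for all $u_1,u_2\in\mathbb B_{\epsilon_{\bar u}}(\bar u)\cap\mathcal U$ (where $T_z$ is multivalued, the inequality is understood for all elements of $T_z(u_1)$, $T_z(u_2)$). The dual problem is locally strongly convex at $y_z$ if $\Phi_z$ is strongly convex (with some modulus $\mu>0$) on some ball $\mathbb B_r(y_z)$, $r>0$. Prox-bounded: there is $\gamma>0$ with $E_{\gamma f}(x)>-\infty$ for some $x$; the threshold $\lambda_f$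 is the supremum of all such $\gamma$. NSSR: lsc functions $f,g:\mathbb X\to\overline{\mathbb R}$ satisfy NSSR at $\bar x\in\operatorname{dom} f\cap\operatorname{dom} g$ if there exist $\tau,\delta\in(0,+\infty)$ such that $\partial(f+g)(x)\cap\mathbb B_d(0)\subseteq\partial f(x)\cap\tau\mathbb B_d(0)+\partial g(x)\cap\tau\mathbb B_d(0)$ for all $x\in\mathbb B_\delta(\bar x)\cap\operatorname{dom} f\cap\operatorname{dom} g$ and all $d\in(0,1]$. Prox-regularity: $f$ is prox-regular at $\bar x$ for $\bar v$ with constant $\rho$ if $f$ is finite and locally lsc at $\bar x$, $\bar v\in\partial f(\bar x)$, and there is $\epsilon>0$ such that $f(x')\ge f(x)+\langle v,x'-x\rangle-\frac\rho2\|x'-x\|^2$ for all $x'\in\mathbb B_\epsilon(\bar x)$ whenever $x\in\mathbb B_\epsilon(\bar x)$, $f(x)<f(\bar x)+\epsilon$, $v\in\partial f(x)\cap\mathbb B_\epsilon(\bar v)$. *)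

(* Defs.v *)
From HB Require Import structures.
From mathcomp Require Import all_boot all_order all_algebra.
From mathcomp Require Import all_classical all_reals all_analysis.
From mathcomp Require Import sesquilinear.

Set Implicit Arguments.
Unset Strict Implicit.
Unset Printing Implicit Defensive.

Import Order.TTheory GRing.Theory Num.Theory.
Import numFieldNormedType.Exports.

Local Open Scope classical_set_scope.
Local Open Scope ring_scope.

(* Finite-dimensional real Hilbert spaces.  Completeness is automatic in finite
   dimension, hence not an axiom; with [idfun] as the twisting morphism the form
   is an ordinary bilinear symmetric positive definite form. *)
HB.mixin Record NormedVector_isHilbert (R : realType) (V : Type)
    of NormedModule R V & Vector R V := {
  inner : {dot V for (@idfun R)};
  inner_normE : forall x : V, inner x x = `|x| ^+ 2
}.

#[short(type="finHilbertType")]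
HB.structure Definition FinHilbert (R : realType) :=
  {V of NormedModule R V & Vector R V & NormedVector_isHilbert R V}.

Section Riesz.
Variables (R : realType) (V : finHilbertType R).

Lemma innerC (u v : V) : inner u v = inner v u.
Proof. by rewrite hermC /= expr0 mul1r. Qed.

Lemma riesz (phi : {linear V -> R^o}) :
  exists w : V, forall x, phi x = inner x w.
Proof.
pose g (w : V) : 'Hom(V, R^o) := linfun (inner w : V -> R^o).
have gE w x : g w x = inner w x by rewrite lfunE.
have glin : linear g.
  move=> a u v; apply/lfunP => x.
  by rewrite add_lfunE scale_lfunE !gE linearPl.
pose gL : {linear V -> 'Hom(V, R^o)} :=
  HB.pack g (GRing.isLinear.Build _ _ _ _ g glin).
pose G := linfun gL.
have kerG : lker G == 0%VS.
  apply/lker0P => u v; rewrite !lfunE /= => guv; apply/eqP.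
  rewrite -subr_eq0 -normr_eq0 -sqrf_eq0 -inner_normE.
  have := congr1 (fun h : 'Hom(V, R^o) => h (u - v)) guv.
  rewrite !gE => e.
  by rewrite linearBl subr_eq0; apply/eqP.

have fullG : limg G = fullv.
  apply/eqP; rewrite eqEdim subvf /= limg_dim_eq.
    by rewrite !dimvf /dim /= muln1.
  by rewrite (eqP kerG) capv0.
have /memv_imgP[w _ wE] : linfun phi \in limg G by rewrite fullG memvf.
exists w => x; rewrite -(lfunE phi) wE.
by rewrite lfunE /= gE innerC.
Qed.

End Riesz.

Section Definitions.
Variable R : realType.

Definition adjoint (X Y : finHilbertType R) (A : {linear X -> Y}) (y : Y) : X :=
  xget 0 [set w | forall x, inner (A x) y = inner x w].

Lemma adjointP (X Y : finHilbertType R) (A : {linear X -> Y}) (x : X) (y : Y) :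
  inner (A x) y = inner x (adjoint A y).
Proof.
have philin : linear (fun x0 => inner (A x0) y : R^o).
  by move=> a u v; rewrite linearP linearPl.
pose phi : {linear X -> R^o} :=
  HB.pack (fun x0 => inner (A x0) y : R^o) (GRing.isLinear.Build _ _ _ _ _ philin).
have [w wE] := riesz phi.
by have /(_ x) := @xgetI _ 0 [set w | forall x, inner (A x) y = inner x w] w wE.
Qed.

Local Open Scope ereal_scope.

Section Functions.
Variable X : finHilbertType R.
Implicit Types (f g h : X -> \bar R) (x v t : X).

Definition edom f : set X := [set x | f x < +oo].

Definition proper_fun f := (forall x, f x != -oo) /\ edom f !=set0.

Definition indicator (E : set X) x : \bar R := if x \in E then 0 else +oo.

Definition escale (a : R) f x : \bar R := a%:E * f x.

(* The argmin of a function identically [+oo] is empty. *)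
Definition argmin f : set X := [set x | f x < +oo /\ forall y, f x <= f y].

Definition moreau_env h t : \bar R :=
  ereal_inf (range (fun x => h x + (`|x - t| ^+ 2 / 2)%:E)).

Definition prox h t : set X :=
  argmin (fun x => h x + (`|x - t| ^+ 2 / 2)%:E).

Definition prox_params f : set R :=
  [set gamma | (0 < gamma)%R /\ exists x, -oo < moreau_env (escale gamma f) x].

Definition prox_bounded f := prox_params f !=set0.

Definition prox_threshold f : \bar R := ereal_sup [set g%:E | g in prox_params f].

(* f(y) >= f(x) + <v, y - x> + o(|y - x|) *)
Definition regular_subdiff f x : set X :=
  [set v | f x \is a fin_num /\
    forall e : R, (0 < e)%R -> \forall y \near x,
      f x + (inner v (y - x))%:E - (e * `|y - x|)%:E <= f y].

Definition limiting_subdiff f x : set X :=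
  [set v | f x \is a fin_num /\
    exists xs vs : nat -> X,
      [/\ xs @ \oo --> x, f \o xs @ \oo --> f x, vs @ \oo --> v &
          forall n, regular_subdiff f (xs n) (vs n)]].

Definition nssr f g (xbar : X) :=
  exists tau delta : R, [/\ (0 < tau)%R, (0 < delta)%R &
    forall x, (ball xbar delta `&` edom f `&` edom g) x ->
    forall d : R, (0 < d <= 1)%R ->
      limiting_subdiff (f \+ g) x `&` ball (0%R : X) d `<=`
      [set (v + w)%R |
        v in limiting_subdiff f x `&` ball (0%R : X) (tau * d)%R
      & w in limiting_subdiff g x `&` ball (0%R : X) (tau * d)%R]].

(* Rockafellar--Wets: the level sets of f near xbar, at levels up to slightly
   above f(xbar), are closed. *)
Definition locally_lsc_at f (xbar : X) :=
  exists2 e : R, (0 < e)%R & forall a : R, a%:E <= f xbar + e%:E ->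
    closed [set x | (`|x - xbar| <= e)%R /\ f x <= a%:E].

Definition prox_regular f (xbar vbar : X) (rho : R) :=
  [/\ f xbar \is a fin_num, locally_lsc_at f xbar, limiting_subdiff f xbar vbar &
    exists2 e : R, (0 < e)%R & forall x v,
      ball xbar e x -> f x < f xbar + e%:E ->
      limiting_subdiff f x v -> ball vbar e v ->
      forall x', ball xbar e x' ->
        f x + (inner v (x' - x))%:E - (rho / 2 * `|x' - x| ^+ 2)%:E <= f x'].

(* [T] is set-valued; only its values on [U] matter. *)
Definition locally_strongly_monotone (U : set X) (T : X -> set X) (ubar : X) :=
  exists e c : R, [/\ (0 < e)%R, (0 < c)%R &
    forall u1 u2, (ball ubar e `&` U) u1 -> (ball ubar e `&` U) u2 ->
    forall t1 t2, T u1 t1 -> T u2 t2 ->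
      (c * `|u1 - u2| ^+ 2 <= inner (t1 - t2) (u1 - u2))%R].

Definition strongly_convex_on (C : set X) (mu : R) h :=
  forall x y, C x -> C y -> forall t : R, (0 <= t <= 1)%R ->
    h (t *: x + (1 - t) *: y)%R + (mu / 2 * t * (1 - t) * `|x - y| ^+ 2)%:E
      <= t%:E * h x + (1 - t)%:E * h y.

Definition locally_strongly_convex h (xbar : X) :=
  exists r mu : R,
    [/\ (0 < r)%R, (0 < mu)%R & strongly_convex_on (ball xbar r) mu h].

End Functions.

Section Dual.
Variables (X Y : finHilbertType R) (lambda : R) (b : Y) (f : X -> \bar R).
Variables (A : {linear X -> Y}) (z : X).

Definition dual_obj (y : Y) : \bar R :=
  - ereal_inf (range (fun x =>
      lambda%:E * f x + (`|x - z| ^+ 2 / 2)%:E + (inner y (b - A x))%:E)).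

Definition prox_shift (u : X) : set X := prox (escale lambda f) (z + u)%R.

End Dual.

End Definitions.

(* Main.v *)
From HB Require Import structures.
Require Import Defs.
From mathcomp Require Import all_boot all_order all_algebra.
From mathcomp Require Import all_classical all_reals all_analysis.
From mathcomp Require Import sesquilinear ring lra.

(** The Lagrangian at [y] and the function whose minimizers form
    [prox_shift lambda f z (adjoint A y)] differ by a constant in [x]: complete
    the square.  So a proximal point [t] at the shift [adjoint A y] attains the
    infimum that defines the dual objective at [y], and the residual [A t - b] is
    a subgradient of the dual objective there ([dual_obj_subgradient]).  As
    [lambda] is below the threshold of prox-boundedness, the functions to be
    minimized are coercive, so proximal points always exist
    ([prox_shift_nonempty]).  The dual objective is therefore a finite convex
    function with an explicit, everywhere nonempty set-valued selection [S] of
    its subdifferential.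

    The equivalence rests on two facts.  First, for any real function with such a
    selection, local strong convexity is the same as local strong monotonicity of
    the selection ([strongly_monotone_convex], [strongly_convex_monotone]); no
    differentiability is involved, because one subgradient at the midpoint of a
    segment already turns monotonicity into quadratic growth.  Second, [A] being
    onto, the norms of [y] and of [adjoint A y] are comparable, so that strong
    monotonicity of [S] at [y] is strong monotonicity of the proximal map on the
    range of the adjoint ([strongly_monotone_adjoint]).  A strongly convex
    minimum of a convex function is its only one ([strongly_convex_unique_min]).

    What ties [z] to [xbar] is the existence of a dual solution
    ([dual_solution_near]).  The hypothesis on the proximal point [xbar] says
    that [f x] is at least [f xbar - rho / 2 * `|x - xbar| ^+ 2] everywhere; as
    [lambda * rho < 1], the primal objective with [z = xbar] grows quadratically
    away from [xbar].  Hence the minimizer [xz] of the primal problem is within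
    a constant multiple of [`|z - xbar|] from [xbar].  Its optimality gives the
    small subgradient [lambda^-1 *: (z - xz)] of [f + indicator], which the sum
    rule splits into a small subgradient [v] of [f] and a normal to the affine
    constraint, that is [adjoint A y1] for some [y1] ([normal_affine]).
    Prox-regularity applied to [v] near [xbar], and the growth of [f] far from
    it, show that [xz] is a global proximal point at the shift
    [adjoint A (- lambda *: y1)].  It is also feasible, so [0] is a subgradient
    of the dual objective at [- lambda *: y1]. *)

Set Implicit Arguments.
Unset Strict Implicit.
Unset Printing Implicit Defensive.

Import Order.TTheory GRing.Theory Num.Theory.
Import numFieldNormedType.Exports.

Local Open Scope classical_set_scope.
Local Open Scope ring_scope.

(** * Inner products and finite dimension *)

Section Inner.
Variables (R : realType) (V : finHilbertType R).
Implicit Types (u v w : V) (a : R).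

Lemma innerDl u v w : inner (u + v) w = inner u w + inner v w.
Proof. exact: linearDl. Qed.

Lemma innerNl u w : inner (- u) w = - inner u w.
Proof. exact: linearNl. Qed.

Lemma innerZl a u w : inner (a *: u) w = a * inner u w.
Proof. exact: linearZl_LR. Qed.

Lemma innerDr u v w : inner w (u + v) = inner w u + inner w v.
Proof. by rewrite innerC innerDl 2!(innerC _ w). Qed.

Lemma innerNr u w : inner w (- u) = - inner w u.
Proof. by rewrite innerC innerNl innerC. Qed.

Lemma innerZr a u w : inner w (a *: u) = a * inner w u.
Proof. by rewrite innerC innerZl innerC. Qed.

Lemma inner0l u : inner 0 u = 0.
Proof. by rewrite -(scale0r 0) innerZl mul0r. Qed.

Definition innerE :=
  (innerDl, innerDr, innerNl, innerNr, innerZl, innerZr).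

Lemma sqr_norm u : `|u| ^+ 2 = inner u u.
Proof. by rewrite inner_normE. Qed.

(** Expand the square of the norm of [`|v| *: u - `|u| *: v]. *)
Lemma cauchy_schwarz u v : inner u v <= `|u| * `|v|.
Proof.
have [->|u0] := eqVneq u 0; first by rewrite inner0l normr0 mul0r.
have [->|v0] := eqVneq v 0; first by rewrite innerC inner0l normr0 mulr0.
have : 0 <= `|(`|v| *: u - `|u| *: v)| ^+ 2 by rewrite sqr_ge0.
rewrite sqr_norm !innerE -!sqr_norm (innerC v u).
have : 0 < `|u| by rewrite normr_gt0.
have : 0 < `|v| by rewrite normr_gt0.
set p := `|u|; set q := `|v|; set i := inner u v => q0 p0 h.
have pq : 0 < p * q by rewrite mulr_gt0.
have {}h : 0 <= p * q * (p * q - i) by lra.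
by move: h; rewrite pmulr_rge0 // subr_ge0.
Qed.

Lemma cauchy_schwarz_abs u v : `|inner u v| <= `|u| * `|v|.
Proof.
rewrite ler_norml cauchy_schwarz andbT lerNl -innerNl -(normrN u).
exact: cauchy_schwarz.
Qed.

Lemma inner_ext u v : (forall x, inner x u = inner x v) -> u = v.
Proof.
move=> uv; apply/eqP; rewrite -subr_eq0 -normr_eq0 -sqrf_eq0 sqr_norm.
by rewrite innerDr innerNr uv subrr.
Qed.

End Inner.

(** Vectors with the same inner product against every vector are equal, so an
    identity between linear combinations of vectors becomes one between reals, in
    the reach of [ring] and [field]. *)
Ltac hilbert_ring := apply: inner_ext => ?; rewrite !innerE; ring.
Ltac hilbert_field := apply: inner_ext => ?; rewrite !innerE; field.

Section FiniteDimension.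
Variable R : realType.

(** Riesz vectors of the coordinate forms of a basis: coordinates become inner
    products, to which Cauchy-Schwarz applies. *)
Lemma dual_frame (V : finHilbertType R) :
  exists n, exists e w : 'I_n -> V, forall v, v = \sum_i inner v (w i) *: e i.
Proof.
pose phi i : {linear V -> R^o} := coord (vbasis (@fullv R V)) i.
have /choice[w wE] : forall i, exists w : V, forall x, phi i x = inner x w.
  by move=> i; exact: riesz.
exists (\dim (@fullv R V)), (fun i => (vbasis (@fullv R V))`_i), w => v.
rewrite {1}(coord_vbasis (memvf v)).
by apply: eq_bigr => i _; rewrite -wE.
Qed.

Lemma linear_bound (V W : finHilbertType R) (L : {linear V -> W}) :
  exists2 c : R, 0 < c & forall v, `|L v| <= c * `|v|.
Proof.
have [n [e [w eE]]] := dual_frame V.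
exists (1 + \sum_i `|w i| * `|L (e i)|).
  by rewrite ltr_pwDl// sumr_ge0// => i _; rewrite mulr_ge0.
move=> v; rewrite [in X in X <= _](eE v) linear_sum.
apply: le_trans (ler_norm_sum _ _ _) _.
rewrite mulrDl mul1r ler_wpDl// mulr_suml.
apply: ler_sum => i _; rewrite linearZ normrZ mulrAC ler_wpM2r// mulrC.
exact: cauchy_schwarz_abs.
Qed.

Lemma linear_continuous_hilbert (V W : finHilbertType R) (L : {linear V -> W}) :
  continuous L.
Proof.
have [c c0 cP] := linear_bound L => x.
apply/cvgrPdist_lt => e e0; apply/nbhs_ballP; exists (e / c); first by rewrite /= divr_gt0.
move=> y; rewrite -ball_normE /= => xy; rewrite -linearB.
by apply: le_lt_trans (cP _) _; rewrite mulrC -ltr_pdivlMr.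
Qed.

(** The synthesis map [g] of a dual frame is continuous, and the coordinates of a
    bounded set are bounded, so the set is the image under [g] of a compact set
    of row vectors. *)
Lemma bounded_closed_compact_hilbert (V : finHilbertType R) (K : set V) (M : R) :
  (forall x, K x -> `|x| <= M) -> closed K -> compact K.
Proof.
move=> KM Kc.
have [n [e [w eE]]] := dual_frame V.
pose g (r : 'rV[R]_n) : V := \sum_i r 0 i *: e i.
pose c (x : V) : 'rV[R]_n := \row_i inner x (w i).
have gK x : g (c x) = x.
  by rewrite [RHS]eE; apply: eq_bigr => i _; rewrite mxE.
have gc : continuous g.
  move=> r; apply: (@cvg_big _ _ _ _ _ _ _ (nbhs r)) => [|i _]; first exact: add_continuous.
  by apply: (@cvgZr_tmp _ _ _ (nbhs r)); exact: coord_continuous.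
pose k := \sum_i `|w i|.
pose B := [set r : 'rV[R]_n | `|r| <= M * k] `&` g @^-1` K.
have Bc : compact B.
  apply: bounded_closed_compact.
  - exists (M * k); split; first exact: num_real.
    by move=> x Mx r [/= rM _]; apply: le_trans rM (ltW Mx).
  - apply: closedI; last by apply: closed_comp => // x _; exact: gc.
    rewrite (_ : [set _ | _] = (fun r => `|r|) @^-1` [set x : R | x <= M * k])//.
    apply: closed_comp; last exact: closed_le.
    by move=> x _; exact: norm_continuous.
rewrite (_ : K = g @` B).
  by apply: continuous_compact => //; exact: continuous_subspaceT.
rewrite eqEsubset; split=> [x Kx|_ [r [_ Kr] <-]//].
exists (c x) => //; split; rewrite /= ?gK//.
have M0 : 0 <= M by rewrite (le_trans _ (KM _ Kx)).
rewrite /Num.norm/= mx_normrE.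
apply: bigmax_le => [|[i j] _ /=]; first by rewrite mulr_ge0// sumr_ge0.
rewrite mxE (le_trans (cauchy_schwarz_abs _ _))// ler_pM ?KM//.
by rewrite /k (bigD1 j)//= lerDl sumr_ge0.
Qed.

End FiniteDimension.

(** * Attainment of minima *)

Section Minimizers.
Variables (R : realType) (X : finHilbertType R).

Lemma seq_argmin (I : eqType) (h : I -> \bar R) (s : seq I) :
  s != [::] -> exists2 x, x \in s & forall y, y \in s -> (h x <= h y)%E.
Proof.
elim: s => // x s IHs _.
have [->|/IHs[m ms mP]] := eqVneq s [::].
  by exists x; rewrite ?mem_head// => y; rewrite inE => /eqP ->.
have [hxm|hmx] := leP (h x) (h m).
  exists x; first exact: mem_head.
  move=> y; rewrite inE => /orP[/eqP ->//|/mP]; exact: le_trans.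
exists m; first by rewrite inE ms orbT.
by move=> y; rewrite inE => /orP[/eqP ->|/mP//]; exact: ltW.
Qed.

(** Without a minimum, the open sets [h > h y], for [y] in the compact part [K] of
    [C] where minimizers can lie, would cover [K]; the lowest point [y] of a finite
    subcover would then satisfy [h y > h y'] for another of its points [y']. *)
Lemma lsc_min_attained (h : X -> \bar R) (C : set X) (x0 : X) (M : R) :
  (forall x, h x != -oo%E) -> lower_semicontinuous h ->
  closed C -> C x0 -> (forall x, C x -> (h x <= h x0)%E -> `|x| <= M) ->
  exists2 x, C x & forall y, C y -> (h x <= h y)%E.
Proof.
move=> hNy hlsc Cc Cx0 hM.
apply: contrapT => nomin.
pose K := C `&` [set x | `|x| <= M].
have Kx0 : K x0 by split=> //=; exact: hM.
have Kc : compact K.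
  apply: (@bounded_closed_compact_hilbert _ _ _ M) => [x []//|].
  apply: closedI => //.
  rewrite (_ : [set _ | _] = (fun r => `|r|) @^-1` [set x : R | x <= M])//.
  apply: closed_comp; last exact: closed_le.
  by move=> x _; exact: norm_continuous.
have descent x : K x -> exists2 y, K y & (h y < h x)%E.
  move=> Kx; apply: contrapT => noy.
  have hxx0 : (h x <= h x0)%E.
    by rewrite leNgt; apply/negP => ?; apply: noy; exists x0.
  apply: nomin; exists x; first by case: Kx.
  move=> y Cy; rewrite leNgt; apply/negP => hyx; apply: noy; exists y => //.
  by split=> //=; apply: hM => //; exact: le_trans (ltW hyx) hxx0.
move: Kc; rewrite compact_cover => /(_ _ K (fun y => [set x | (h y < h x)%E])).
case=> [y _|x /descent[y Ky hyx]|D DK KD]; [|by exists y|].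
  have [hy|] := boolP (h y \is a fin_num).
    by rewrite -(fineK hy); move/lower_semicontinuousP : hlsc; exact.
  rewrite fin_numE hNy/= negbK => /eqP ->.
  rewrite (_ : [set _ | _] = set0); first exact: open0.
  by rewrite -subset0 => x /=; rewrite ltNge leey.
have Dnil : finmap.enum_fset D != [::].
  apply/eqP => D0; have [y /= yD _] := KD _ Kx0.
  have : y \in finmap.enum_fset D by exact: yD.
  by rewrite D0.
have [m mD mP] := seq_argmin h Dnil.
have Km : K m by have /set_mem := DK _ mD.
have [y /= yD] := KD _ Km.
by rewrite ltNge mP.
Qed.

End Minimizers.

(** * Quadratic penalization of a prox-bounded function *)

Section Penalized.
Variables (R : realType) (X : finHilbertType R) (lambda : R) (f : X -> \bar R).
Hypothesis lambda_gt0 : 0 < lambda.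
Hypothesis fNy : forall x, f x != -oo%E.

Lemma efinP (x : X) : (f x < +oo)%E -> exists a, f x = a%:E.
Proof.
by case: (f x) (fNy x) => [a||]// _ _; exists a.
Qed.

(** Since [f] avoids [-oo], minimality against the points where [f] is finite is
    all there is to check, and there the comparison is between reals. *)
Lemma argmin_addP (q : X -> R) (t : X) :
  argmin (fun x => lambda%:E * f x + (q x)%:E)%E t <->
  exists2 a, f t = a%:E &
    forall y p, f y = p%:E -> lambda * a + q t <= lambda * p + q y.
Proof.
split=> [[]|[a fta tP]].
  case fta : (f t) (fNy t) => [a||]//; last by rewrite gt0_muley.
  move=> _ _ tP; exists a => // y p fyp.
  by have := tP y; rewrite /= fyp -!EFinM -!EFinD lee_fin.
split; first by rewrite /= fta -EFinM -EFinD ltry.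
move=> y; rewrite /= fta; case fy : (f y) (fNy y) => [p||]// _.
  by rewrite -!EFinM -!EFinD lee_fin; exact: tP.
by rewrite gt0_muley// addye// leey.
Qed.

Lemma lsc_add_continuous (q : X -> R) :
  lower_semicontinuous f -> continuous q ->
  lower_semicontinuous (fun x => lambda%:E * f x + (q x)%:E)%E.
Proof.
move=> flsc qc x a ax.
(* Split the slack between [f], which may be [+oo] at [x], and [q]. *)
have [p [e [e0 pfx ape]]] : exists p e,
    [/\ 0 < e, (p%:E < f x)%E & a <= lambda * p + (q x - e)].
  case fx : (f x) ax (fNy x) => [s||]// ax _.
    move: ax; rewrite -EFinM -EFinD lte_fin => ax.
    pose d := (lambda * s + q x - a) / 2.
    have d0 : 0 < d by rewrite divr_gt0// subr_gt0.
    exists (s - d / lambda), d; split=> //.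
      by rewrite lte_fin ltrBlDr ltrDl divr_gt0.
    rewrite mulrBr mulrCA divff ?gt_eqF// mulr1 /d; lra.
  exists ((a - q x + 1) / lambda), 1; split => //; first by rewrite ltry.
  rewrite mulrCA divff ?gt_eqF// mulr1; lra.
have [V Vx VP] := flsc _ _ pfx.
have Wx : \forall y \near x, q x - e < q y.
  have /cvgrPdist_lt/(_ e e0) := qc x.
  apply: filterS => y; rewrite distrC ltr_norml => /andP[+ _]; lra.
exists (V `&` [set y | q x - e < q y]); first exact: filterI.
move=> y [/VP pfy /= qy].
case fy : (f y) pfy (fNy y) => [s||]// ps _.
  rewrite -EFinM -EFinD lte_fin.
  have : lambda * p < lambda * s by rewrite ltr_pM2l.
  lra.
by rewrite gt0_muley// addye// ltry.
Qed.

(** The bound [theta < 1] leaves a positive part of the penalty [`|x - w| ^+ 2 / 2]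
    uncompensated, which makes the penalized function coercive. *)
Definition quad_minorized := exists x0 c theta, 0 <= theta < 1 /\
  forall y p, f y = p%:E -> c - theta / 2 * `|y - x0| ^+ 2 <= lambda * p.

(** A parameter [g > lambda] whose Moreau envelope is above [-oo] at some point [x0]
    bounds [g * f] from below by a constant minus half the squared distance to
    [x0]; rescaling by [lambda / g < 1] gives [theta]. *)
Lemma threshold_quad_minorized :
  proper_fun f -> (lambda%:E < prox_threshold f)%E -> quad_minorized.
Proof.
move=> [_ [x1 x1dom]] /ereal_sup_gt[_ [g [g0 [x0 infNy]] <-]].
rewrite lte_fin => lg.
have [x1a fx1] := efinP x1dom.
set I := moreau_env _ _ in infNy.
have Ile y p : f y = p%:E -> (I <= (g * p + `|y - x0| ^+ 2 / 2)%:E)%E.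
  move=> fy; apply: ereal_inf_lbound; exists y => //.
  by rewrite /escale fy -EFinM -EFinD.
have [m Im] : exists m, I = m%:E.
  have := Ile _ _ fx1; case: I infNy {Ile} => [m||]// _ _; by exists m.
exists x0, (lambda / g * m), (lambda / g); split.
  by rewrite divr_ge0 ?ltW//= ltr_pdivrMr// mul1r.
move=> y p /Ile; rewrite Im lee_fin => mp.
have : lambda / g * m <= lambda / g * (g * p + `|y - x0| ^+ 2 / 2).
  by rewrite ler_wpM2l// divr_ge0// ltW.
rewrite mulrDr mulrA divfK ?gt_eqF//; lra.
Qed.

Lemma sublevel_bounded (w : X) (B : R) : quad_minorized ->
  exists M, forall y p, f y = p%:E ->
    lambda * p + `|y - w| ^+ 2 / 2 <= B -> `|y| <= M.
Proof.
move=> [x0 [c [th [/andP[th0 th1] fP]]]].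
pose k := `|w - x0|.
pose B' := `|B - c + th / 2 * k ^+ 2|.
(* Beyond [N] the quadratic term exceeds the linear one plus [B']. *)
pose N := 1 + 2 / (1 - th) * (B' + th * k).
exists (N + `|w|) => y p /fP cp pB.
have yw : `|y| <= `|y - w| + `|w| by rewrite -{1}(subrK w y) ler_normD.
apply: le_trans yw _; rewrite lerD2r leNgt; apply/negP => Nn.
have : `|y - x0| <= `|y - w| + k.
  by rewrite (_ : y - x0 = (y - w) + (w - x0)) ?ler_normD// addrA subrK.
have k0 : 0 <= k by exact: normr_ge0.
have n0 : 0 <= `|y - x0| by exact: normr_ge0.
have B0 : 0 <= B' by exact: normr_ge0.
have BB : B - c + th / 2 * k ^+ 2 <= B' by exact: ler_norm.
have d0 : 0 < 1 - th by lra.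
have {}Nn : 1 <= `|y - w| /\ (1 - th) / 2 + B' + th * k < (1 - th) / 2 * `|y - w|.
  have h : 0 <= 2 / (1 - th) * (B' + th * k).
    by rewrite !mulr_ge0 ?addr_ge0 ?mulr_ge0 ?invr_ge0// ltW.
  split; first by move: Nn; rewrite /N; lra.
  have := Nn; rewrite -(@ltr_pM2l _ ((1 - th) / 2)) ?divr_gt0//.
  apply: le_lt_trans; rewrite le_eqVlt; apply/orP; left; apply/eqP.
  rewrite /N; field; lra.
move: Nn cp pB BB.
set n := `|y - w|; set l := `|y - x0| in n0 *.
move=> [n1 nN] cp pB BB ln.
have l2 : th * l ^+ 2 <= th * (n + k) ^+ 2.
  by rewrite ler_wpM2l// lerXn2r ?nnegrE// addr_ge0// (le_trans ler01).
have : 0 < n * ((1 - th) / 2 * n - ((1 - th) / 2 + B' + th * k)).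
  by rewrite mulr_gt0 ?subr_gt0// (lt_le_trans ltr01).
have : 0 <= (n - 1) * ((1 - th) / 2 + B').
  by rewrite mulr_ge0 ?subr_ge0// addr_ge0// divr_ge0// ltW.
nra.
Qed.

Lemma prox_attained (C : set X) (w x0 : X) :
  quad_minorized -> lower_semicontinuous f -> closed C -> C x0 ->
  (f x0 < +oo)%E ->
  exists x a, [/\ C x, f x = a%:E &
    forall y p, C y -> f y = p%:E ->
      lambda * a + `|x - w| ^+ 2 / 2 <= lambda * p + `|y - w| ^+ 2 / 2].
Proof.
move=> fq flsc Cc Cx0 /efinP[a0 fx0].
pose h x := (lambda%:E * f x + (`|x - w| ^+ 2 / 2)%:E)%E.
have hE x p : f x = p%:E -> h x = (lambda * p + `|x - w| ^+ 2 / 2)%:E.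
  by move=> fx; rewrite /h fx -EFinM -EFinD.
have hy x : f x = +oo%E -> h x = +oo%E.
  by move=> fx; rewrite /h fx gt0_muley// addye.
have hNy x : h x != -oo%E.
  by case fx : (f x) (fNy x) => [p||]// _; rewrite ?(hE _ _ fx) ?hy.
have qc : continuous (fun x : X => `|x - w| ^+ 2 / 2).
  have nc : continuous (fun x : X => `|x - w|).
    move=> x; apply: (@cvg_norm _ _ _ (nbhs x)).
    by apply: cvgB; [exact: cvg_id|exact: cvg_cst].
  by move=> x; apply: cvgM; [apply: cvgM; exact: nc|exact: cvg_cst].
have [M MP] := sublevel_bounded w (lambda * a0 + `|x0 - w| ^+ 2 / 2) fq.
have hM y : C y -> (h y <= h x0)%E -> `|y| <= M.
  move=> _; rewrite (hE _ _ fx0).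
  case fy : (f y) (fNy y) => [p||]// _; last by rewrite hy// leye_eq.
  by rewrite (hE _ _ fy) lee_fin; exact: MP.
have [x Cx xP] := lsc_min_attained hNy (lsc_add_continuous flsc qc) Cc Cx0 hM.
have [a fx] : exists a, f x = a%:E.
  apply: efinP; rewrite ltey; apply/eqP => /hy hx.
  by have := xP _ Cx0; rewrite hx (hE _ _ fx0) leye_eq.
exists x, a; split=> // y p Cy fy.
by have := xP _ Cy; rewrite (hE _ _ fx) (hE _ _ fy) lee_fin.
Qed.

End Penalized.

(** * Strong convexity through subgradients *)

Section StrongConvexity.
Variables (R : realType) (Y : finHilbertType R).
Variables (G : Y -> R) (S : Y -> set Y).
Hypothesis S_nonempty : forall y, S y !=set0.
Hypothesis S_subgradient :
  forall y s, S y s -> forall y', G y + inner s (y' - y) <= G y'.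

Lemma ball_convex (c x y : Y) (r t : R) : 0 <= t <= 1 ->
  ball c r x -> ball c r y -> ball c r (t *: x + (1 - t) *: y).
Proof.
move=> /andP[t0 t1]; rewrite -!ball_normE /= => xr yr.
have -> : c - (t *: x + (1 - t) *: y) = t *: (c - x) + (1 - t) *: (c - y).
  by hilbert_ring.
apply: le_lt_trans (ler_normD _ _) _.
rewrite !normrZ (ger0_norm t0) ger0_norm ?subr_ge0//.
have [->|tN0] := eqVneq t 0; first by rewrite mul0r add0r subr0 mul1r.
have : t * `|c - x| < t * r by rewrite ltr_pM2l// lt_def tN0.
have : (1 - t) * `|c - y| <= (1 - t) * r by rewrite ler_wpM2l ?subr_ge0// ltW.
lra.
Qed.

(** Let [p] be a subgradient at the midpoint [m] of [u1] and [u2].  The subgradient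
    inequalities at [u1] towards [m] and at [m] towards [u2], together with strong
    monotonicity between [u1] and [m], give growth along the segment with half of
    the optimal modulus.  Growth from every point yields strong convexity, as
    subgradient inequalities yield convexity. *)
Lemma strongly_monotone_convex (yb : Y) :
  locally_strongly_monotone setT S yb ->
  locally_strongly_convex (EFin \o G) yb.
Proof.
move=> [e [c [e0 c0 mono]]].
have growth u1 u2 s1 : ball yb e u1 -> ball yb e u2 -> S u1 s1 ->
    G u1 + inner s1 (u2 - u1) + c / 4 * `|u2 - u1| ^+ 2 <= G u2.
  move=> u1e u2e s1S.
  pose m := 2^-1 *: u2 + (1 - 2^-1) *: u1.
  have me : ball yb e m by apply: ball_convex => //; lra.
  have mu1 : m - u1 = 2^-1 *: (u2 - u1).
    by rewrite /m; hilbert_field.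
  have mu2 : u2 - m = 2^-1 *: (u2 - u1).
    by rewrite /m; hilbert_field.
  have [p pS] := S_nonempty m.
  have := mono m u1 (conj me I) (conj u1e I) p s1 pS s1S.
  have := S_subgradient s1S m; have := S_subgradient pS u2.
  rewrite mu1 mu2 !innerE normrZ ger0_norm// exprMn => h1 h2 h3.
  move: h1 h2 h3; rewrite -!innerE.
  lra.
exists e, (c / 2); split=> //; first by rewrite divr_gt0.
move=> x y xe ye t t01.
rewrite /= -!EFinM -!EFinD lee_fin.
set u := t *: x + (1 - t) *: y.
have ue : ball yb e u by exact: ball_convex.
have [s sS] := S_nonempty u.
have := growth _ _ _ ue xe sS; have := growth _ _ _ ue ye sS.
have -> : x - u = (1 - t) *: (x - y).
  by rewrite /u; hilbert_ring.
have -> : y - u = - t *: (x - y).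
  by rewrite /u; hilbert_ring.
rewrite !normrZ !exprMn !real_normK ?num_real//; case/andP: t01 => t0 t1.
rewrite !innerZr.
set d := `|x - y| ^+ 2; set i := inner s _.
set gx := G x; set gy := G y; set gu := G u => hy hx.
have {}hy : 0 <= (1 - t) * (gy - (gu + - t * i + c / 4 * ((- t) ^+ 2 * d))).
  by rewrite mulr_ge0// subr_ge0.
have {}hx : 0 <= t * (gx - (gu + (1 - t) * i + c / 4 * ((1 - t) ^+ 2 * d))).
  by rewrite mulr_ge0// subr_ge0.
nra.
Qed.

(** Compare the strong convexity inequality at the midpoint with the subgradient
    inequalities at both ends. *)
Lemma strongly_convex_monotone (yb : Y) :
  locally_strongly_convex (EFin \o G) yb ->
  locally_strongly_monotone setT S yb.
Proof.
move=> [r [mu [r0 mu0 conv]]].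
exists r, (mu / 2); split=> //; first by rewrite divr_gt0.
move=> u1 u2 [u1r _] [u2r _] s1 s2 s1S s2S.
have := conv _ _ u1r u2r 2^-1; rewrite /= -!EFinM -!EFinD lee_fin.
set m := _ + _ *: u2.
have := S_subgradient s1S m; have := S_subgradient s2S m.
have -> : m - u1 = - 2^-1 *: (u1 - u2) by rewrite /m; hilbert_field.
have -> : m - u2 = 2^-1 *: (u1 - u2) by rewrite /m; hilbert_field.
rewrite !innerZr innerDl innerNl.
have h : 0 <= (2^-1 : R) <= 1 by lra.
move=> h1 h2 /(_ h).
lra.
Qed.

(** If [y] also minimizes [G], so does by convexity each point of the segment from
    [yb] to [y], in particular the point [yt], which lies in the ball of strong
    convexity; there two minimizers must coincide. *)
Lemma strongly_convex_unique_min (yb y : Y) :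
  locally_strongly_convex (EFin \o G) yb ->
  (forall y', G yb <= G y') -> (forall y', G y <= G y') -> y = yb.
Proof.
move=> [r [mu [r0 mu0 conv]]] ybmin ymin.
(* The ratio puts [yt] in the ball of radius [r] and stays at most [1]. *)
pose t := r / (r + `|y - yb|).
have den0 : 0 < r + `|y - yb| by rewrite ltr_pwDl.
have t0 : 0 < t by rewrite divr_gt0.
have t1 : t <= 1 by rewrite ler_pdivrMr// mul1r lerDl.
pose yt := t *: y + (1 - t) *: yb.
have ytE : yt - yb = t *: (y - yb).
  by rewrite /yt; hilbert_ring.
have ytr : ball yb r yt.
  rewrite -ball_normE /= distrC ytE normrZ gtr0_norm// /t mulrAC.
  by rewrite ltr_pdivrMr// ltr_pM2l// ltrDr.
have Gyt : G yt <= G yb.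
  have [s sS] := S_nonempty yt.
  have := S_subgradient sS y; have := S_subgradient sS yb.
  have -> : yb - yt = - t *: (y - yb) by rewrite -opprB ytE scaleNr.
  have -> : y - yt = (1 - t) *: (y - yb).
    by rewrite /yt; hilbert_ring.
  rewrite !innerZr; have := ymin yb.
  set i := inner _ _; set gb := G yb; set gt := G yt; set gy := G y.
  move=> hm h1 h2.
  have : 0 <= (1 - t) * (gb - (gt + - t * i)) by rewrite mulr_ge0// subr_ge0.
  have : 0 <= t * (gy - (gt + (1 - t) * i)) by rewrite mulr_ge0 ?subr_ge0// ltW.
  have : 0 <= t * (gb - gy) by rewrite mulr_ge0 ?subr_ge0// ltW.
  nra.
have h : 0 <= (2^-1 : R) <= 1 by lra.
have := conv _ _ (ballxx yb r0) ytr _ h.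
rewrite /= -!EFinM -!EFinD lee_fin.
have := ybmin (2^-1 *: yb + (1 - 2^-1) *: yt).
rewrite distrC ytE normrZ exprMn real_normK ?num_real// => h1 h2.
have h3 : mu / 8 * t ^+ 2 * `|y - yb| ^+ 2 <= 0 by lra.
apply/eqP; rewrite -subr_eq0 -normr_eq0 -sqrf_eq0 eq_le sqr_ge0 andbT.
by move: h3; rewrite pmulr_rle0// mulr_gt0 ?exprn_gt0// divr_gt0.
Qed.

End StrongConvexity.

(** * The adjoint of a surjective map *)

Section Adjoint.
Variables (R : realType) (X Y : finHilbertType R) (A : {linear X -> Y}).
Hypothesis A_surj : forall y : Y, exists x : X, A x = y.

Lemma adjointB (y y' : Y) : adjoint A (y - y') = adjoint A y - adjoint A y'.
Proof. by apply: inner_ext => x; rewrite -adjointP !innerE !adjointP. Qed.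

Lemma adjoint_bound : exists2 c : R, 0 < c & forall y, `|adjoint A y| <= c * `|y|.
Proof.
have [c c0 cP] := linear_bound A; exists c => // y.
have [->|w0] := eqVneq (adjoint A y) 0.
  by rewrite normr0 mulr_ge0// ltW.
rewrite -(@ler_pM2l _ `|adjoint A y|) ?normr_gt0// -expr2 sqr_norm.
rewrite -adjointP (le_trans (cauchy_schwarz _ _))// mulrA ler_wpM2r//.
by rewrite mulrC cP.
Qed.

(** A linear right inverse [g] of [A] gives [`|y| ^+ 2 = inner (A (g y)) y], that is
    [inner (g y) (adjoint A y)]. *)
Lemma adjoint_bound_below :
  exists2 k : R, 0 < k & forall y, `|y| <= k * `|adjoint A y|.
Proof.
have [k k0 kP] := linear_bound ((linfun A)^-1)%VF; exists k => // y.
have AK : A (((linfun A)^-1)%VF y) = y.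
  rewrite -[LHS](lfunE A) limg_lfunVK//.
  by have [x <-] := A_surj y; rewrite -(lfunE A) memv_img// memvf.
have [->|y0] := eqVneq y 0; first by rewrite normr0 mulr_ge0// ltW.
rewrite -(@ler_pM2l _ `|y|) ?normr_gt0// -expr2 sqr_norm.
rewrite -{1}AK adjointP (le_trans (cauchy_schwarz _ _))//.
by rewrite mulrCA mulrA ler_wpM2r// kP.
Qed.

(** The change of variable [u = adjoint A y] preserves the pairing,
    [inner (A t1 - A t2) (y1 - y2)] being
    [inner (t1 - t2) (adjoint A y1 - adjoint A y2)], and distorts norms by bounded
    factors only. *)
Lemma strongly_monotone_adjoint (b : Y) (T : X -> set X) (y0 : Y) :
  locally_strongly_monotone (range (adjoint A)) T (adjoint A y0) <->
  locally_strongly_monotone setT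
    (fun y => [set A t - b | t in T (adjoint A y)]) y0.
Proof.
have [c c0 cP] := adjoint_bound; have [k k0 kP] := adjoint_bound_below.
have innerA (t1 t2 : X) (y1 y2 : Y) :
    inner (A t1 - b - (A t2 - b)) (y1 - y2)
    = inner (t1 - t2) (adjoint A y1 - adjoint A y2).
  by rewrite opprB addrA subrK -linearB adjointP adjointB.
split=> -[e [m [e0 m0 mono]]].
- exists (e / c), (m / k ^+ 2); split; rewrite ?divr_gt0 ?exprn_gt0//.
  have ballA y : ball y0 (e / c) y -> ball (adjoint A y0) e (adjoint A y).
    rewrite -!ball_normE /= -adjointB => h; apply: le_lt_trans (cP _) _.
    by rewrite mulrC -ltr_pdivlMr.
  move=> y1 y2 [y1e _] [y2e _] _ _ [t1 t1T <-] [t2 t2T <-].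
  rewrite innerA; apply: le_trans (mono _ _ _ _ _ _ t1T t2T); last 2 first.
    by split; [exact: ballA|exists y1].
    by split; [exact: ballA|exists y2].
  rewrite mulrAC -mulrA ler_pM2l// ler_pdivrMr ?exprn_gt0//.
  by rewrite -exprMn mulrC -adjointB lerXn2r ?nnegrE// mulr_ge0// ltW.
- exists (e / k), (m / c ^+ 2); split; rewrite ?divr_gt0 ?exprn_gt0//.
  move=> u1 u2 [u1e [y1 _ yu1]] [u2e [y2 _ yu2]] t1 t2 t1T t2T.
  subst u1 u2.
  rewrite -innerA.
  have ballA y : ball (adjoint A y0) (e / k) (adjoint A y) -> ball y0 e y.
    rewrite -!ball_normE /= -adjointB => h; apply: le_lt_trans (kP _) _.
    by rewrite mulrC -ltr_pdivlMr.
  have := mono _ _ (conj (ballA _ u1e) I) (conj (ballA _ u2e) I) _ _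
    (imageP _ t1T) (imageP _ t2T).
  apply: le_trans.
  rewrite mulrAC -mulrA ler_pM2l// ler_pdivrMr ?exprn_gt0//.
  by rewrite -exprMn mulrC -adjointB lerXn2r ?nnegrE// mulr_ge0// ltW.
Qed.

End Adjoint.

(** * The dual objective *)

Section Dual.
Variables (R : realType) (X Y : finHilbertType R) (lambda : R) (b : Y).
Variables (f : X -> \bar R) (A : {linear X -> Y}) (z : X).
Hypothesis lambda_gt0 : 0 < lambda.
Hypothesis fNy : forall x, f x != -oo%E.

(** Expanding the square around [z] leaves [- inner x u] plus a constant. *)
Lemma prox_shiftP (u t : X) :
  prox_shift lambda f z u t <->
  exists2 a, f t = a%:E & forall x p, f x = p%:E ->
    lambda * a + `|t - z| ^+ 2 / 2 - inner t u
    <= lambda * p + `|x - z| ^+ 2 / 2 - inner x u.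
Proof.
have sqE (x : X) :
    `|x - (z + u)| ^+ 2 / 2
    = `|x - z| ^+ 2 / 2 - inner x u + (inner z u + inner u u / 2).
  by rewrite !sqr_norm !innerE (innerC u x) (innerC u z) (innerC z x); field.
have proxE : prox_shift lambda f z u t <-> _ :=
  argmin_addP lambda_gt0 fNy (fun x => `|x - (z + u)| ^+ 2 / 2) t.
split=> [/proxE[a fta tP]|[a fta tP]]; [|apply/proxE];
  exists a => // x p /tP; rewrite !sqE; lra.
Qed.

(** The point [t] attains the infimum defining the dual objective at [y] and is one
    of the competitors at any other [y'], where the value of the Lagrangian at [t]
    is affine in [y']. *)
Lemma dual_obj_subgradient (y : Y) (t : X) :
  prox_shift lambda f z (adjoint A y) t ->
  dual_obj lambda b f A z y \is a fin_num /\
  forall y', (dual_obj lambda b f A z y + (inner (A t - b) (y' - y))%:E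
              <= dual_obj lambda b f A z y')%E.
Proof.
move=> /prox_shiftP[a fta tP].
pose L y := lambda * a + `|t - z| ^+ 2 / 2 + inner y (b - A t).
have lower y' : ((- L y')%:E <= dual_obj lambda b f A z y')%E.
  rewrite EFinN leeN2; apply: ereal_inf_lbound; exists t => //.
  by rewrite fta -EFinM -!EFinD.
have dualE : dual_obj lambda b f A z y = (- L y)%:E.
  apply/eqP; rewrite eq_le lower andbT EFinN leeN2.
  apply: le_ereal_inf_tmp => _ [x _ <-].
  case fx : (f x) (fNy x) => [p||]// _; last first.
    by rewrite gt0_muley// !addye// leey.
  rewrite -EFinM -!EFinD lee_fin /L.
  have := tP _ _ fx; rewrite !(innerDr, innerNr) !(innerC y (A _)) !adjointP; lra.
rewrite dualE; split=> // y'; rewrite -EFinD.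
apply: le_trans (lower y'); rewrite lee_fin /L !innerE.
rewrite !(innerC b) !(innerC (A t)); lra.
Qed.

Hypothesis f_min : quad_minorized lambda f.
Hypothesis f_lsc : lower_semicontinuous f.
Hypothesis f_dom : edom f !=set0.

Lemma prox_shift_nonempty (u : X) : prox_shift lambda f z u !=set0.
Proof.
have [x0 x0dom] := f_dom.
have [t [a [_ fta tP]]] :=
  prox_attained lambda_gt0 fNy (z + u) f_min f_lsc closedT (I : setT x0) x0dom.
exists t; apply/(argmin_addP lambda_gt0 fNy (fun x => `|x - (z + u)| ^+ 2 / 2) t).
by exists a => // y p; exact: tP.
Qed.

(** The residuals [A t - b] are a nonempty selection [S] of subgradients of the dual
    objective, and the adjoint carries strong monotonicity of the proximal map to
    that of [S]. *)
Lemma dual_monotone_iff_convex (yz : Y) :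
  argmin (dual_obj lambda b f A z) yz ->
  (forall y : Y, exists x : X, A x = y) ->
  (locally_strongly_monotone (range (adjoint A)) (prox_shift lambda f z)
     (adjoint A yz)
   <->
   argmin (dual_obj lambda b f A z) = [set yz] /\
   locally_strongly_convex (dual_obj lambda b f A z) yz).
Proof.
move=> [_ yzmin] A_surj.
pose Phi := dual_obj lambda b f A z; pose G y := fine (Phi y).
pose S y := [set A t - b | t in prox_shift lambda f z (adjoint A y)].
have Phi_fin y : Phi y \is a fin_num.
  have [t tT] := prox_shift_nonempty (adjoint A y).
  by have [] := dual_obj_subgradient tT.
have PhiE : Phi = EFin \o G by apply/funext => y; rewrite /= fineK.
have S0 y : S y !=set0.
  by have [t tT] := prox_shift_nonempty (adjoint A y); exists (A t - b), t.
have Ssub y s : S y s -> forall y', G y + inner s (y' - y) <= G y'.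
  move=> [t tT <-] y'; have [_ /(_ y')] := dual_obj_subgradient tT.
  by rewrite -/Phi PhiE -EFinD lee_fin.
rewrite -/Phi PhiE.
split=> [/(strongly_monotone_adjoint A_surj b) mono|[_ conv]]; last first.
  apply/(strongly_monotone_adjoint A_surj b).
  exact: (@strongly_convex_monotone _ _ G S Ssub yz conv).
have conv := strongly_monotone_convex S0 Ssub mono.
split=> //; rewrite eqEsubset; split=> [y [_ ymin]|_ ->].
  apply: (strongly_convex_unique_min S0 Ssub conv) => y'.
    by have := yzmin y'; rewrite -/Phi PhiE lee_fin.
  by have := ymin y'; rewrite lee_fin.
by split; [exact: ltry|move: yzmin; rewrite -/Phi PhiE].
Qed.

End Dual.

(** * Existence of a dual solution *)

Section NormalCone.
Variables (R : realType) (X Y : finHilbertType R) (A : {linear X -> Y}) (b : Y).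
Hypothesis A_surj : forall y : Y, exists x : X, A x = y.

(** A vector orthogonal to the kernel of [A] defines a linear form on [Y] through
    any preimage under [A]; its Riesz vector is the [y] sought. *)
Lemma kernel_orthogonal_range (w : X) :
  (forall h, A h = 0 -> inner w h = 0) -> exists y, w = adjoint A y.
Proof.
move=> worth; have [s sK] := choice A_surj.
have wA x x' : A x = A x' -> inner w x = inner w x'.
  move=> AE; apply/eqP; rewrite -subr_eq0 -innerNr -innerDr worth//.
  by rewrite linearB AE subrr.
(* The section [s] of [A] comes from choice and need not be linear; by [wA] the
   form is linear all the same. *)
have slin : linear (fun y => inner w (s y) : R^o).
  move=> a u v.
  rewrite (wA _ (a *: s u + s v)); first by rewrite innerDr innerZr.
  by rewrite linearP !sK.
pose phi : {linear Y -> R^o} :=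
  HB.pack (fun y => inner w (s y) : R^o) (GRing.isLinear.Build _ _ _ _ _ slin).
have [y yE] := riesz phi.
exists y; apply: inner_ext => x.
by rewrite -adjointP -yE innerC; apply: wA; rewrite sK.
Qed.

Local Notation E := [set x | A x = b].

Lemma indicator_fin_num (x : X) : indicator E x \is a fin_num -> A x = b.
Proof. by rewrite /indicator; case: ifPn => [/set_mem|]. Qed.

(** Move from [x] by a small multiple of [h], within the affine set. *)
Lemma regular_normal_affine (x w h : X) :
  regular_subdiff (indicator E) x w -> A h = 0 -> inner w h <= 0.
Proof.
move=> [xfin wreg] Ah; have Ax := indicator_fin_num xfin.
have inE y : A y = b -> indicator E y = 0%E by move=> Ay; rewrite /indicator mem_set.
rewrite leNgt; apply/negP => wh.
have hN0 : 0 < `|h|.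
  rewrite normr_gt0; apply/eqP => h0.
  by move: wh; rewrite h0 innerC inner0l ltxx.
(* With this slope, half of the linear gain [t * inner w h] remains. *)
pose e := inner w h / (2 * `|h|).
have e0 : 0 < e by rewrite divr_gt0// mulr_gt0.
have /nbhs_ballP[r /= r0 rP] := wreg _ e0.
pose t := r / (2 * `|h|).
have t0 : 0 < t by rewrite divr_gt0// mulr_gt0.
have xt : ball x r (x + t *: h).
  rewrite -ball_normE /= opprD addNKr normrN normrZ gtr0_norm// /t.
  rewrite invfM mulrA mulfVK ?gt_eqF//; lra.
have Axt : A (x + t *: h) = b by rewrite linearD linearZ/= Ah scaler0 addr0.
have := rP _ xt; rewrite /= !inE// add0e -EFinD lee_fin.
rewrite addrAC subrr add0r normrZ (gtr0_norm t0).
rewrite innerZr mulrCA -mulrBr pmulr_rle0// /e invfM mulrA mulfVK ?gt_eqF//; lra.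
Qed.

(** Regular normals are orthogonal to the kernel of [A], and orthogonality passes
    to limits. *)
Lemma normal_affine (x w : X) :
  limiting_subdiff (indicator E) x w -> exists y, w = adjoint A y.
Proof.
move=> [_ [xs [ws [_ _ wsw wsreg]]]].
apply: kernel_orthogonal_range => h Ah.
have ws0 n : inner (ws n) h = 0.
  apply/eqP; rewrite eq_le (regular_normal_affine (wsreg n) Ah)/=.
  rewrite -oppr_le0 -innerNr; apply: (regular_normal_affine (wsreg n)).
  by rewrite linearN Ah oppr0.
apply/eqP; rewrite -normr_le0; apply/ler_addgt0Pl => e e0; rewrite addr0.
have d0 : 0 < e / (1 + `|h|) by rewrite divr_gt0// ltr_pwDl.
have /cvgrPdist_lt/(_ _ d0)[N _ /(_ N (leqnn N)) /= wN] := wsw.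
have -> : inner w h = inner (w - ws N) h by rewrite innerDl innerNl ws0 subr0.
apply: le_trans (cauchy_schwarz_abs _ _) _.
rewrite ltr_pdivlMr ?ltr_pwDl// in wN.
apply: le_trans _ (ltW wN); rewrite ler_wpM2l// lerDr//.
Qed.

End NormalCone.

Section ConstrainedProx.
Variables (R : realType) (X Y : finHilbertType R) (lambda rho : R) (b : Y).
Variables (f : X -> \bar R) (A : {linear X -> Y}) (xbar : X).
Hypothesis lambda_gt0 : 0 < lambda.
Hypothesis fNy : forall x, f x != -oo%E.
Local Notation E := [set x | A x = b].

(** Optimality bounds [f] from below on the affine set by a quadratic with gradient
    [lambda^-1 *: (z - xz)] at [xz]; its second order part is absorbed by
    [e * `|y - xz|] near [xz]. *)
Lemma constrained_min_subgradient (z xz : X) (a : R) :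
  A xz = b -> f xz = a%:E ->
  (forall y p, A y = b -> f y = p%:E ->
     lambda * a + `|xz - z| ^+ 2 / 2 <= lambda * p + `|y - z| ^+ 2 / 2) ->
  limiting_subdiff (f \+ indicator E)%E xz (lambda^-1 *: (z - xz)).
Proof.
move=> Axz fxz xzmin.
have hxz : (f \+ indicator E)%E xz = a%:E.
  by rewrite /= fxz /indicator mem_set// adde0.
have reg : regular_subdiff (f \+ indicator E)%E xz (lambda^-1 *: (z - xz)).
  split; first by rewrite hxz.
  move=> e e0; apply/nbhs_ballP; exists (2 * lambda * e); first by rewrite /= !mulr_gt0.
  move=> y; rewrite -ball_normE /= distrC => ye.
  rewrite hxz; case fy : (f y) (fNy y) => [p||]// _; last first.
    by rewrite /indicator; case: ifP => _; rewrite ?adde0 ?addye// leey.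
  rewrite /indicator; case: ifPn => [/set_mem/= Ay|_]; last by rewrite addey// leey.
  rewrite adde0 -!EFinD lee_fin.
  have := xzmin _ _ Ay fy.
  have -> : `|y - z| ^+ 2 = `|xz - z| ^+ 2 - 2 * inner (z - xz) (y - xz) + `|y - xz| ^+ 2.
    rewrite !sqr_norm !innerE (innerC z y) (innerC xz z) (innerC xz y); ring.
  rewrite innerZl; set i := inner _ _; set n := `|y - xz| in ye *.
  have n0 : 0 <= n by exact: normr_ge0.
  set u := _ ^+ 2 => h.
  have {}h : a + lambda^-1 * (i - n ^+ 2 / 2) <= p.
    rewrite -(@ler_pM2l _ lambda)// mulrDr mulrA divff ?gt_eqF// mul1r; lra.
  have : lambda^-1 * (n ^+ 2 / 2) <= e * n.
    rewrite ler_pdivrMl// expr2 mulrAC mulrA ler_wpM2r//; lra.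
  lra.
split; first by rewrite hxz.
exists (fun=> xz), (fun=> lambda^-1 *: (z - xz)).
by split=> //; exact: cvg_cst.
Qed.

(** The proximal inequality at [xbar], multiplied by [rho]. *)
Lemma prox_growth : 0 < rho < lambda^-1 ->
  prox (escale rho^-1 f) xbar = [set xbar] ->
  exists2 a, f xbar = a%:E & forall y p, f y = p%:E ->
    a - rho / 2 * `|y - xbar| ^+ 2 <= p.
Proof.
move=> /andP[rho0 _] xbar_prox.
have : prox (escale rho^-1 f) xbar xbar by rewrite xbar_prox.
have ri0 : 0 < rho^-1 by rewrite invr_gt0.
have proxE : prox (escale rho^-1 f) xbar xbar <-> _ :=
  argmin_addP ri0 fNy (fun x => `|x - xbar| ^+ 2 / 2) xbar.
move=> /proxE[a fa aP]; exists a => // y p /aP.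
rewrite subrr normr0 expr0n/= mul0r addr0 ler_pdivrMl// mulrDr mulrA divff ?gt_eqF// mul1r.
lra.
Qed.

(** Feasibility of [xz] makes the subgradient [A xz - b] vanish. *)
Lemma dual_min_of_prox (z : X) (y : Y) (xz : X) :
  prox_shift lambda f z (adjoint A y) xz -> A xz = b ->
  argmin (dual_obj lambda b f A z) y.
Proof.
move=> /(dual_obj_subgradient b lambda_gt0 fNy)[yfin ymin] Axz.
split; first by rewrite -(fineK yfin) ltry.
by move=> y'; have := ymin y'; rewrite Axz subrr inner0l adde0.
Qed.

(** Compare the value of the primal objective at its minimizer [xz] with the value at
    [xbar], using the growth of [f] around [xbar]. *)
Lemma constrained_min_close (kappa a p : R) (z xz : X) :
  kappa = 1 - lambda * rho -> 0 < kappa ->  0 < rho ->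
  a - rho / 2 * `|xz - xbar| ^+ 2 <= p ->
  lambda * p + `|xz - z| ^+ 2 / 2 <= lambda * a + `|xbar - z| ^+ 2 / 2 ->
  kappa / 2 * `|xz - xbar| <= `|xbar - z| /\
  lambda * p <= lambda * a + `|xbar - z| ^+ 2 / 2.
Proof.
move=> kE k0 rho0 growth zmin.
set s := `|xz - xbar| in growth *; set r := `|xbar - z| in zmin *.
have s0 : 0 <= s by exact: normr_ge0.
have r0 : 0 <= r by exact: normr_ge0.
split; last by have := sqr_ge0 `|xz - z|; lra.
have expand : s ^+ 2 - 2 * s * r + r ^+ 2 <= `|xz - z| ^+ 2.
  rewrite /s /r -[xz - z](subrKA xbar).
  move: (xz - xbar) (xbar - z) => u u'.
  have := cauchy_schwarz_abs u u'; rewrite ler_norml => /andP[+ _].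
  by rewrite (sqr_norm (u + u')) innerDl !innerDr -!sqr_norm (innerC u' u); lra.
have {}growth : lambda * (a - rho / 2 * s ^+ 2) <= lambda * p by rewrite ler_pM2l.
have [->|sN0] := eqVneq s 0; first by rewrite mulr0.
have sp : 0 < s by rewrite lt_def sN0.
rewrite -(ler_pM2l sp) kE; nra.
Qed.

(** Far from [xbar] the growth inequality beats every perturbation: as
    [`|x - xbar| >= e], the margin [kappa / 2 * `|x - xbar| ^+ 2] dominates the errors
    made in replacing [xz] and [z] by [xbar] and [v] by [0], each bounded by a
    fraction of [kappa * e]. *)
Lemma prox_inequality_far (kappa e a p p' : R) (z xz x v : X) :
  kappa = 1 - lambda * rho -> 0 < kappa -> 0 < rho -> 0 < e ->
  a - rho / 2 * `|x - xbar| ^+ 2 <= p' ->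
  lambda * p <= lambda * a + `|xbar - z| ^+ 2 / 2 ->
  `|xz - xbar| <= kappa * e / 8 -> `|xbar - z| <= kappa * e / 8 ->
  lambda * `|v| <= kappa * e / 8 ->
  e <= `|x - xbar| ->
  lambda * p + lambda * inner v (x - xz) <= lambda * p' + `|x - xz| ^+ 2 / 2.
Proof.
move=> kE k0 rho0 e0 growth pa.
have := ler_normD (x - xz) (xz - xbar); rewrite addrA subrK.
have := ler_normD (x - xbar) (xbar - xz); rewrite addrA subrK (distrC xbar xz).
have /(ler_wpM2l (ltW lambda_gt0)) := cauchy_schwarz v (x - xz).
have {}growth : lambda * (a - rho / 2 * `|x - xbar| ^+ 2) <= lambda * p'.
  by rewrite ler_pM2l.
move: growth pa (normr_ge0 (x - xz)) (normr_ge0 (xz - xbar)) (normr_ge0 (xbar - z)).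
set n := `|x - xz|; set s := `|xz - xbar|; set r := `|xbar - z|.
set l := `|x - xbar|; set i := inner _ _.
move=> growth pa n0 s0 r0 vi n_le n_ge sk rk vk el.
have k1 : kappa <= 1 by rewrite kE; have := mulr_gt0 lambda_gt0 rho0; lra.
have kl : kappa * e <= kappa * l by rewrite ler_pM2l.
have l0 : 0 < l by exact: lt_le_trans el.
have kl1 : kappa * l <= l by rewrite ger_pMl.
have vn : lambda * i <= kappa * l / 8 * (l + s).
  rewrite mulrA in vi; apply: le_trans vi _.
  by apply: ler_pM => //; [rewrite mulr_ge0// ltW|lra].
have ls : l - s <= n by lra.
have n2 : (l - s) ^+ 2 <= n ^+ 2 by rewrite lerXn2r ?nnegrE//; lra.
have r2 : r ^+ 2 <= (kappa * l / 8) ^+ 2 by rewrite lerXn2r ?nnegrE//; lra.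
have ls8 : l * s <= l * (kappa * l / 8) by rewrite ler_pM2l//; lra.
have kls : kappa * l * s <= l * s by rewrite ler_wpM2r.
have kl2 : (kappa * l) ^+ 2 <= kappa * l ^+ 2.
  rewrite exprMn ler_wpM2r ?sqr_ge0// expr2 ger_pMl//.
have := mulr_gt0 k0 (mulr_gt0 l0 l0).
nra.
Qed.

End ConstrainedProx.

Section DualExistence.
Variables (R : realType) (X Y : finHilbertType R) (lambda rho : R) (b : Y).
Variables (f : X -> \bar R) (A : {linear X -> Y}) (xbar : X).
Hypothesis lambda_gt0 : 0 < lambda.
Hypothesis fNy : forall x, f x != -oo%E.
Hypothesis f_min : quad_minorized lambda f.
Hypothesis f_lsc : lower_semicontinuous f.
Hypothesis A_surj : forall y : Y, exists x : X, A x = y.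

Lemma closed_affine : closed [set x | A x = b].
Proof.
rewrite (_ : [set x | _] = A @^-1` [set b])//.
apply: closed_comp; first by move=> x _; exact: linear_continuous_hilbert.
exact: (accessible_closed_set1 (hausdorff_accessible (@norm_hausdorff _ Y))).
Qed.

(** The radius [d] makes the multiplier [v] small enough for prox-regularity and for
    [prox_inequality_far]; the radius [r] then keeps [xz] near [xbar], its value
    below [f xbar + e], and the subgradient of the primal objective below [d]. *)
Lemma dual_solution_near :
  ([set x | A x = b] `&` edom f) xbar ->
  nssr f (indicator [set x | A x = b]) xbar ->
  0 < rho < lambda^-1 ->
  prox_regular f xbar 0 rho ->
  prox (escale rho^-1 f) xbar = [set xbar] ->
  \forall z \near xbar, argmin (dual_obj lambda b f A z) !=set0.
Proof.
move=> [Axb xbdom] [tau [delta [tau0 delta0 sumrule]]] rho_bounds.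
move=> [_ _ _ [e e0 preg]] /(prox_growth fNy rho_bounds)[a fa growth].
have /andP[rho0 rhol] := rho_bounds.
have [kappa kE] : exists kappa, kappa = 1 - lambda * rho by exists (1 - lambda * rho).
have kappa0 : 0 < kappa.
  by rewrite kE subr_gt0 mulrC -ltr_pdivlMr// mul1r.
have lr0 : 0 < lambda * rho by rewrite mulr_gt0.
have kappa1 : kappa < 1 by rewrite kE; lra.
have [d [d0 d1 de dk]] : exists d, [/\ 0 < d, d <= 1, tau * d <= e
    & lambda * (tau * d) <= kappa * e / 8].
  exists (Num.min 1 (Num.min (e / tau) (kappa * e / 8 / lambda / tau))).
  rewrite !lt_min !ge_min lexx; split => //=.
  - by rewrite ltr01 !divr_gt0// mulr_gt0.
  - rewrite mulrC -ler_pdivlMr//.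
    by rewrite !ge_min lexx orbT.
  - rewrite mulrC -ler_pdivlMr// mulrC -ler_pdivlMr//.
    by rewrite !ge_min lexx !orbT.
have [r [r0 r1 re [rd rd' rk]]] : exists r, [/\ 0 < r, r <= 1, r <= lambda * e &
   [/\ r <= kappa / 2 * delta, r <= kappa * lambda * d / 3
       & r <= kappa / 2 * (kappa * e / 8)]].
  exists (Num.min 1 (Num.min (lambda * e) (Num.min (kappa / 2 * delta)
    (Num.min (kappa * lambda * d / 3) (kappa / 2 * (kappa * e / 8)))))).
  rewrite !lt_min !ge_min !lexx !orbT; split => //=.
  by rewrite ltr01/= ?(mulr_gt0, divr_gt0).
apply/nbhs_ballP; exists r => //= z; rewrite -ball_normE /= => zr.
have [xz [p [Axz fxz xzmin]]] :=
  prox_attained lambda_gt0 fNy z f_min f_lsc closed_affine Axb xbdom.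
have [sr pa] := constrained_min_close lambda_gt0 kE kappa0 rho0 (growth _ _ fxz)
  (xzmin _ _ Axb fa).
have k20 : 0 < kappa / 2 by rewrite divr_gt0.
have s_lt c : r <= kappa / 2 * c -> `|xz - xbar| < c.
  move=> rc; rewrite -(ltr_pM2l k20).
  exact: le_lt_trans sr (lt_le_trans zr rc).
have sdelta := s_lt _ rd; have ske := s_lt _ rk.
have ke : kappa * e / 8 < e.
  have : kappa * e < e by rewrite gtr_pMl.
  lra.
have rke : r <= kappa * e / 8.
  apply: le_trans rk _; rewrite ger_pMl ?divr_gt0 ?mulr_gt0//; lra.
have subz : limiting_subdiff (f \+ indicator [set x | A x = b])%E xz
    (lambda^-1 *: (z - xz)).
  exact: (constrained_min_subgradient lambda_gt0 fNy Axz fxz xzmin).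
have zd : ball (0 : X) d (lambda^-1 *: (z - xz)).
  rewrite -ball_normE /= sub0r normrN normrZ gtr0_norm ?invr_gt0//.
  rewrite mulrC ltr_pdivrMr//.
  have : `|z - xz| <= `|xbar - z| + `|xz - xbar|.
    rewrite (distrC xbar) (distrC xz).
    by rewrite -[z - xz](subrKA xbar) ler_normD.
  have : kappa / 2 * `|xz - xbar| < kappa / 2 * (2 / 3 * (d * lambda)) by lra.
  rewrite (ltr_pM2l k20).
  have : kappa * lambda * d < lambda * d by rewrite -mulrA gtr_pMl// mulr_gt0.
  lra.
have fin_xz : (ball xbar delta `&` edom f `&` edom (indicator [set x | A x = b])) xz.
  split; first split.
  - by rewrite -ball_normE /= distrC.
  - by rewrite /edom /= fxz ltry.
  - by rewrite /edom /= /indicator mem_set// ltry.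
have d01 : 0 < d <= 1 by rewrite d0.
have [v [vsub vd] [w [wsub _] vwE]] := sumrule _ fin_xz _ d01 _ (conj subz zd).
have [y1 y1E] := normal_affine A_surj wsub.
have vtd : `|v| < tau * d by move: vd; rewrite -ball_normE /= sub0r normrN.
exists (- lambda *: y1).
apply: (dual_min_of_prox lambda_gt0 fNy _ Axz).
apply/(prox_shiftP z lambda_gt0 fNy).
exists p => // x p' fx.
(* The shift is chosen so that the proximal objective is centred at
     [xz + lambda *: v]. *)
have -> : adjoint A (- lambda *: y1) = xz - z + lambda *: v.
  have -> : adjoint A (- lambda *: y1) = - lambda *: adjoint A y1.
    by apply: inner_ext => x'; rewrite -adjointP !innerZr adjointP.
  rewrite -y1E -(addrK v w) (addrC w) vwE scalerBr scalerA mulNr divff ?gt_eqF//.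
  by hilbert_ring.
have key : lambda * p + lambda * inner v (x - xz)
           <= lambda * p' + `|x - xz| ^+ 2 / 2.
  have [xe|xe] := ltP `|x - xbar| e.
    have := preg xz v _ _ vsub _ x _.
    rewrite -!ball_normE /= sub0r normrN (distrC xbar xz) (distrC xbar x).
    rewrite fxz fx fa -!EFinD !lte_fin lee_fin.
    have pe : p < a + e.
      rewrite -(ltr_pM2l lambda_gt0) mulrDr.
      apply: le_lt_trans pa _; rewrite ltrD2l.
      have n0 := normr_ge0 (xbar - z).
      have : `|xbar - z| ^+ 2 <= `|xbar - z|.
        by rewrite expr2 ler_piMl//; lra.
      lra.
    move=> /(_ (lt_trans ske ke) pe (lt_le_trans vtd de) xe).
    rewrite -(ler_pM2l lambda_gt0).
    have : 0 <= kappa * `|x - xz| ^+ 2 by rewrite mulr_ge0// ltW.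
    rewrite kE; lra.
  apply: (prox_inequality_far lambda_gt0 kE kappa0 rho0 e0 (growth _ _ fx) pa (ltW ske)) => //.
    exact: ltW (lt_le_trans zr rke).
  by apply: le_trans dk; rewrite ler_pM2l// ltW.
move: key; rewrite (_ : `|x - xz| ^+ 2
    = `|x - z| ^+ 2 - `|xz - z| ^+ 2 - 2 * inner (x - xz) (xz - z)).
  rewrite !innerE (innerC v x) (innerC v xz) (innerC xz v); lra.
rewrite !sqr_norm !innerE (innerC z x) (innerC xz x) (innerC z xz); ring.
Qed.

End DualExistence.

Theorem theorem4 (R : realType) (X Y : finHilbertType R) (lambda rho : R)
    (b : Y) (f : X -> \bar R) (A : {linear X -> Y}) (xbar : X)
    (lambda_gt0 : 0 < lambda)
    (f_proper : proper_fun f)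
    (f_lsc : lower_semicontinuous f)
    (f_prox_bounded : prox_bounded f)
    (f_threshold : (lambda%:E < prox_threshold f)%E)
    (A_surj : forall y : Y, exists x : X, A x = y)
    (xbar_feasible : ([set x | A x = b] `&` edom f) xbar)
    (f_nssr : nssr f (indicator [set x | A x = b]) xbar)
    (rho_bounds : 0 < rho < lambda^-1)
    (f_prox_regular : prox_regular f xbar 0 rho)
    (xbar_prox : prox (escale rho^-1 f) xbar = [set xbar]) :
  \forall z \near xbar,
    argmin (dual_obj lambda b f A z) !=set0 /\
    forall yz : Y, argmin (dual_obj lambda b f A z) yz ->
      (locally_strongly_monotone (range (adjoint A)) (prox_shift lambda f z)
         (adjoint A yz)
       <->
       argmin (dual_obj lambda b f A z) = [set yz] /\
       locally_strongly_convex (dual_obj lambda b f A z) yz).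
Proof.
have fNy x : f x != -oo%E by have [] := f_proper.
have f_min := threshold_quad_minorized lambda_gt0 fNy f_proper f_threshold.
have near := dual_solution_near lambda_gt0 fNy f_min f_lsc A_surj
  xbar_feasible f_nssr rho_bounds f_prox_regular xbar_prox.
apply: filterS near => z dual_ne; split=> // yz yz_min.
have [_ f_dom] := f_proper.
exact: (dual_monotone_iff_convex lambda_gt0 fNy f_min f_lsc f_dom yz_min A_surj).
Qed.
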